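(* Let $(C,\psi_C)$ be a Coder pair and let $(M,\psi_M)$ be a bicomodule of $(C,\psi_C)$. Then the map $d_c$ on $C^\bullet_{\mathrm{Coder}}(M,C)$ is a coboundary operator, that is, $d_c\circ d_c=0$ (i.e. $d_c^{n+1}\circ d_c^n=0$ for all $n\ge1$).
   Context: Everything is over a field $\mathbb{F}$ of characteristic $0$ (vector spaces, linear maps, $\otimes$, $\mathrm{Hom}$). A coassociative coalgebra is a pair $(C,\Delta)$ with $C$ a vector space and $\Delta:C\to C\otimes C$ linear such that $(\mathrm{Id}_C\otimes\Delta)\circ\Delta=(\Delta\otimes\mathrm{Id}_C)\circ\Delta$. A coderivation of $C$ is a linear map $\psi_C:C\to C$ with $\Delta\circ\psi_C=(\psi_C\otimes\mathrm{Id}_C)\circ\Delta+(\mathrm{Id}_C\otimes\psi_C)\circ\Delta$. A Coder pair $(C,\psi_C)$ is a coassociative coalgebra $C$ with a coderivation $\psi_C$. A $C$-bicomodule is a vector space $M$ with linear maps $\rho_l:M\to C\otimes M$, $\rho_r:M\to M\otimes C$ such that $(\Delta\otimes\mathrm{Id}_M)\circ\rho_l=(\mathrm{Id}_C\otimes\rho_l)\circ\rho_l$, $(\mathrm{Id}_M\otimes\Delta)\circ\rho_r=(\rho_r\otimes\mathrm{Id}_C)\circ\rho_r$ and $(\mathrm{Id}_C\otimes\rho_r)\circ\rho_l=(\rho_l\otimes\mathrm{Id}_C)\circ\rho_r$. A bicomodule (corepresentation) of the Coder pair $(C,\psi_C)$ is a pair $(M,\psi_M)$ with $M$ a $C$-bicomodule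 and $\psi_M:M\to M$ linear such that $\rho_l\circ\psi_M=(\mathrm{Id}_C\otimes\psi_M)\circ\rho_l+(\psi_C\otimes\mathrm{Id}_M)\circ\rho_l$ and $\rho_r\circ\psi_M=(\psi_M\otimes\mathrm{Id}_C)\circ\rho_r+(\mathrm{Id}_M\otimes\psi_C)\circ\rho_r$. For $n\ge0$ let $C_c^n(M,C)=\mathrm{Hom}(M,C^{\otimes n})$ and, for $f\in C_c^n(M,C)$, $$\delta_c(f)=(\mathrm{Id}_C\otimes f)\circ\rho_l+\sum_{i=1}^n(-1)^i(\mathrm{Id}_{C^{\otimes(i-1)}}\otimes\Delta\otimes\mathrm{Id}_{C^{\otimes(n-i)}})\circ f+(-1)^{n+1}(f\otimes\mathrm{Id}_C)\circ\rho_r\in C_c^{n+1}(M,C)$$ (the classical Hochschild coboundary, $\delta_c\circ\delta_c=0$). For $n\ge1$ let $\omega:C_c^n(M,C)\to C_c^n(M,C)$, $\omega(f)=\sum_{i=1}^n(\mathrm{Id}_{C^{\otimes(i-1)}}\otimes\psi_C\otimes\mathrm{Id}_{C^{\otimes(n-i)}})\circ f-f\circ\psi_M$. Set $C^0_{\mathrm{Coder}}(M,C)=0$, $C^1_{\mathrm{Coder}}(M,C)=\mathrm{Hom}(M,C)$, $C^n_{\mathrm{Coder}}(M,C)=C_c^n(M,C)\times C_c^{n-1}(M,C)$ for $n\ge2$, and define $d_c^n:C^n_{\mathrm{Coder}}(M,C)\to C^{n+1}_{\mathrm{Coder}}(M,C)$ by $d_c^1(f)=(\delta_c(f),-\omega(f))$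 and, for $n\ge2$, $d_c^n(f,g)=(\delta_c(f),\delta_c(g)+(-1)^n\omega(f))$. *)

(* Defs.v *)
(* [boolp] supplies the classical eqType and choiceType structures on spaces of
   linear maps; [monalg] supplies the free vector space on a choiceType. *)
From HB Require Import structures.
From mathcomp Require Import all_boot all_algebra.
From mathcomp Require Import finmap.
From mathcomp Require Import boolp.
From mathcomp Require Import monalg.

Set Implicit Arguments.
Unset Strict Implicit.
Unset Printing Implicit Defensive.

Import GRing.Theory.
Local Open Scope quotient_scope.
Local Open Scope ring_scope.

Section LinearMaps.
Variables (F : fieldType) (U V : lmodType F).
Implicit Types (f g h : {linear U -> V}) (a b : F).

HB.instance Definition _ := gen_eqMixin {linear U -> V}.
HB.instance Definition _ := gen_choiceMixin {linear U -> V}.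

Lemma linearP_eq f g : f =1 g -> f = g.
Proof.
case: f g => [f [[fD] [fZ]]] [g [[gD] [gZ]]] /= /funext efg.
case: _ / efg in gD gZ *.
by rewrite (Prop_irrelevance fD gD) (Prop_irrelevance fZ gZ).
Qed.

Fact lzero_linear : linear (fun _ : U => 0 : V).
Proof. by move=> a x y; rewrite scaler0 addr0. Qed.
Fact lopp_linear f : linear (fun x => - f x).
Proof. by move=> a x y; rewrite linearP opprD scalerN. Qed.
Fact ladd_linear f g : linear (fun x => f x + g x).
Proof. by move=> a x y; rewrite !linearP scalerDr addrACA. Qed.
Fact lscale_linear a f : linear (fun x => a *: f x).
Proof.
by move=> b x y; rewrite linearP scalerDr !scalerA [a * b]mulrC.
Qed.

Definition mklinear (h : U -> V) (hlin : linear h) : {linear U -> V} :=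
  HB.pack h (GRing.isLinear.Build F U V *:%R h hlin).

Definition lzero := mklinear lzero_linear.
Definition lopp f := mklinear (lopp_linear f).
Definition ladd f g := mklinear (ladd_linear f g).
Definition lscale a f := mklinear (lscale_linear a f).

Fact laddA : associative ladd.
Proof. by move=> f g h; apply/linearP_eq => x; exact: addrA. Qed.
Fact laddC : commutative ladd.
Proof. by move=> f g; apply/linearP_eq => x; exact: addrC. Qed.
Fact ladd0 : left_id lzero ladd.
Proof. by move=> f; apply/linearP_eq => x; exact: add0r. Qed.
Fact laddN : left_inverse lzero lopp ladd.
Proof. by move=> f; apply/linearP_eq => x; exact: addNr. Qed.
HB.instance Definition _ :=
  GRing.isZmodule.Build {linear U -> V} laddA laddC ladd0 laddN.

Fact lscaleA a b f : lscale a (lscale b f) = lscale (a * b) f.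
Proof. by apply/linearP_eq => x; exact: scalerA. Qed.
Fact lscale1 : left_id 1 lscale.
Proof. by move=> f; apply/linearP_eq => x; exact: scale1r. Qed.
Fact lscaleDr : right_distributive lscale +%R.
Proof. by move=> a f g; apply/linearP_eq => x; exact: scalerDr. Qed.
Fact lscaleDl f : {morph lscale^~ f : a b / a + b}.
Proof. by move=> a b; apply/linearP_eq => x; exact: scalerDl. Qed.
HB.instance Definition _ := GRing.Zmodule_isLmodule.Build F {linear U -> V}
  lscaleA lscale1 lscaleDr lscaleDl.

Lemma lin_addE f g x : (f + g) x = f x + g x. Proof. by []. Qed.
Lemma lin_oppE f x : (- f) x = - f x. Proof. by []. Qed.
Lemma lin_scaleE a f x : (a *: f) x = a *: f x. Proof. by []. Qed.
Lemma lin_zeroE x : (0 : {linear U -> V}) x = 0. Proof. by []. Qed.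
Lemma lin_sumE (I : Type) (r : seq I) (P : pred I) (G : I -> {linear U -> V}) x :
  (\sum_(i <- r | P i) G i) x = \sum_(i <- r | P i) G i x.
Proof. by elim/big_rec2: _ => //= i y f _ <-. Qed.

End LinearMaps.

Definition lid (F : fieldType) (U : lmodType F) : {linear U -> U} := idfun.
Arguments lid {F} U.

Definition lcomp (F : fieldType) (U V W : lmodType F)
  (g : {linear V -> W}) (f : {linear U -> V}) : {linear U -> W} := g \o f.
Lemma lidE (F : fieldType) (U : lmodType F) (x : U) : lid U x = x.
Proof. by []. Qed.
Lemma lcompE (F : fieldType) (U V W : lmodType F) (g : {linear V -> W})
  (f : {linear U -> V}) x : lcomp g f x = g (f x).
Proof. by []. Qed.
Notation "g \oL f" := (lcomp g f) (at level 45, left associativity) : ring_scope.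

(* U (x) V is the free vector space on U * V modulo the bilinearity relations. *)
Section TensorProduct.
Variables (F : fieldType) (U V : lmodType F).

Local Notation free := {malg F[(U * V)%type]}.
Local Notation gen u v := (mkmalgU (u, v) (1 : F) : free).

Inductive tensor_null : free -> Prop :=
| TensorNull0 : tensor_null 0
| TensorNullP a x y : tensor_null x -> tensor_null y -> tensor_null (a *: x + y)
| TensorNullL a u u' v :
    tensor_null (gen (a *: u + u') v - (a *: gen u v + gen u' v))
| TensorNullR a u v v' :
    tensor_null (gen u (a *: v + v') - (a *: gen u v + gen u v')).

Definition tensor_nullb : {pred free} := fun x => `[< tensor_null x >].

Fact tensor_null_closed : zmod_closed tensor_nullb.
Proof.
split=> [|x y /asboolP hx /asboolP hy]; apply/asboolP; first exact: TensorNull0.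
by rewrite addrC -scaleN1r; apply: TensorNullP.
Qed.
HB.instance Definition _ :=
  GRing.isZmodClosed.Build free tensor_nullb tensor_null_closed.

Definition tensor : Type := Quotient.quot tensor_nullb.
HB.instance Definition _ := GRing.Zmodule.on tensor.

Definition tproj (x : free) : tensor := \pi_(Quotient.quot tensor_nullb) x.

Lemma tproj_surj t : exists x, t = tproj x.
Proof. by exists (repr t); rewrite /tproj reprK. Qed.

Lemma tproj_eqP x y : tproj x = tproj y <-> tensor_null (x - y).
Proof.
split=> [/eqP|h]; first by rewrite /tproj -Quotient.idealrBE => /asboolP.
by apply/eqP; rewrite /tproj -Quotient.idealrBE; apply/asboolP.
Qed.

Lemma tprojD x y : tproj (x + y) = tproj x + tproj y.
Proof. exact: (raddfD \pi_(Quotient.quot tensor_nullb)). Qed.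

Definition tscale (a : F) (t : tensor) : tensor := tproj (a *: (repr t : free)).

Lemma tprojZ_subproof a x : tscale a (tproj x) = tproj (a *: x).
Proof.
apply/tproj_eqP; rewrite -scalerBr -[_ *: _]addr0.
apply: TensorNullP; last exact: TensorNull0.
by apply/tproj_eqP; rewrite /tproj reprK.
Qed.

Fact tscaleA a b t : tscale a (tscale b t) = tscale (a * b) t.
Proof. by have [x ->] := tproj_surj t; rewrite !tprojZ_subproof scalerA. Qed.
Fact tscale1 : left_id 1 tscale.
Proof.
by move=> t; have [x ->] := tproj_surj t; rewrite tprojZ_subproof scale1r.
Qed.
Fact tscaleDr : right_distributive tscale +%R.
Proof.
move=> a s t; have [x ->] := tproj_surj s; have [y ->] := tproj_surj t.
by rewrite -tprojD !tprojZ_subproof scalerDr tprojD.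
Qed.
Fact tscaleDl t : {morph tscale^~ t : a b / a + b}.
Proof.
move=> a b; have [x ->] := tproj_surj t.
by rewrite !tprojZ_subproof scalerDl tprojD.
Qed.
HB.instance Definition _ := GRing.Zmodule_isLmodule.Build F tensor
  tscaleA tscale1 tscaleDr tscaleDl.

Lemma tprojZ a x : tproj (a *: x) = a *: tproj x.
Proof. by rewrite -tprojZ_subproof. Qed.

Definition tens (u : U) (v : V) : tensor := tproj (gen u v).

Fact tens_bilinear : bilinear_for *:%R *:%R tens.
Proof.
split=> [v a u u'|u a v v'].
- by rewrite /= /tens -tprojZ -tprojD; apply/tproj_eqP; exact: TensorNullL.
- by rewrite /= /tens -tprojZ -tprojD; apply/tproj_eqP; exact: TensorNullR.
Qed.
HB.instance Definition _ :=
  bilinear_isBilinear.Build F U V tensor *:%R *:%R tens tens_bilinear.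

Lemma tensor_ind (P : tensor -> Prop) :
  P 0 -> (forall a u v t, P t -> P (a *: tens u v + t)) -> forall t, P t.
Proof.
move=> P0 Pcons t; have [x ->] := tproj_surj t.
rewrite [x]monalgE; elim: (enum_fset _) => [|[u v] s IHs].
  rewrite big_nil; suff -> : tproj 0 = 0 by [].
  by apply: (addrI (tproj 0)); rewrite -tprojD !addr0.
rewrite big_cons; set y := \sum_(_ <- _) _ in IHs *.
suff -> : tproj (mkmalgU (u, v) (mcoeff (u, v) x) + y) =
          (mcoeff (u, v) x) *: tens u v + tproj y by exact: Pcons.
rewrite /tens -tprojZ -tprojD; congr (tproj (_ + _)).
by apply/malgP => k; rewrite mcoeffZ !mcoeffU mulr_natr.
Qed.

End TensorProduct.

Notation "u \ox v" := (tens u v) (at level 40, left associativity) : ring_scope.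

Section TensorUniversal.
Variables (F : fieldType) (U V W : lmodType F).

Lemma tensor_lin_eq (f g : {linear tensor U V -> W}) :
  (forall u v, f (u \ox v) = g (u \ox v)) -> f = g.
Proof.
move=> efg; apply: linearP_eq; elim/tensor_ind => [|a u v t IHt].
  by rewrite !linear0.
by rewrite !linearP efg IHt.
Qed.

Variables (B : U -> V -> W) (Bbil : bilinear_for *:%R *:%R B).

Definition free_lift (x : {malg F[(U * V)%type]}) : W :=
  \sum_(k <- msupp x) mcoeff k x *: B k.1 k.2.

Lemma free_liftEw (x : {malg F[(U * V)%type]}) (d : {fset (U * V)%type}) :
  (msupp x `<=` d)%fset -> free_lift x = \sum_(k <- d) mcoeff k x *: B k.1 k.2.
Proof.
move=> sxd; rewrite /free_lift (big_fset_incl _ sxd) //= => k _ /mcoeff_outdom ->.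
by rewrite scale0r.
Qed.

Fact free_lift_linear : linear free_lift.
Proof.
move=> a x y; pose d := (msupp x `|` msupp y `|` msupp (a *: x + y)%R)%fset.
rewrite (@free_liftEw x d) ?(@free_liftEw y d) ?(@free_liftEw (a *: x + y) d);
  last 3 first.
- by rewrite /d fsubsetUr.
- by rewrite /d -fsetUA fsetUCA fsubsetUl.
- by rewrite /d -fsetUA fsubsetUl.
rewrite scaler_sumr -big_split /=; apply: eq_bigr => k _.
by rewrite mcoeffD mcoeffZ scalerDl scalerA.
Qed.

Lemma free_lift_gen u v : free_lift (mkmalgU (u, v) 1) = B u v.
Proof.
rewrite (@free_liftEw _ [fset (u, v)]%fset) ?msuppU_le //.
by rewrite big_seq_fset1 mcoeffUU scale1r.
Qed.

Lemma free_liftB x y : free_lift (x - y) = free_lift x - free_lift y.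
Proof.
by rewrite [x - y]addrC -[- y]scaleN1r free_lift_linear scaleN1r addrC.
Qed.

Lemma free_lift_null x : tensor_null x -> free_lift x = 0.
Proof.
have fP := free_lift_linear; have fB := free_liftB.
have f0 : free_lift 0 = 0 by rewrite /free_lift msupp0 big_seq_fset0.
elim=> {x} [|a x y _ hx _ hy|a u u' v|a u v v'] //.
- by rewrite fP hx hy scaler0 addr0.
- by rewrite fB fP !free_lift_gen Bbil.1 subrr.
- by rewrite fB fP !free_lift_gen Bbil.2 subrr.
Qed.

Definition tlift_fun (t : tensor U V) : W := free_lift (repr t).

Lemma tlift_proj x : tlift_fun (tproj x) = free_lift x.
Proof.
have /tproj_eqP/free_lift_null : tproj (repr (tproj x)) = tproj x.
  by rewrite /tproj reprK.
by rewrite free_liftB => /eqP; rewrite subr_eq0 => /eqP.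
Qed.

Fact tlift_linear : linear tlift_fun.
Proof.
move=> a s t; have [x ->] := tproj_surj s; have [y ->] := tproj_surj t.
by rewrite -tprojZ -tprojD !tlift_proj free_lift_linear.
Qed.

Definition tlift : {linear tensor U V -> W} := mklinear tlift_linear.

Lemma tliftE u v : tlift (u \ox v) = B u v.
Proof. by rewrite /tlift /= /tens tlift_proj free_lift_gen. Qed.

End TensorUniversal.

Section TensorMaps.
Variables (F : fieldType).

Section Tmap.
Variables (U V U' V' : lmodType F).
Variables (f : {linear U -> U'}) (g : {linear V -> V'}).

Fact tmap_bilinear : bilinear_for *:%R *:%R (fun u v => f u \ox g v).
Proof.
by split=> [v a u u'|u a v v']; rewrite linearP ?(tens_bilinear _ _).1
  ?(tens_bilinear _ _).2.
Qed.
Definition tmap : {linear tensor U V -> tensor U' V'} := tlift tmap_bilinear.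

Lemma tmapE u v : tmap (u \ox v) = f u \ox g v. Proof. exact: tliftE. Qed.
End Tmap.

Section Assoc.
Variables (U V W : lmodType F).

Fact tassoc_inner_bilinear (w : W) :
  bilinear_for *:%R *:%R (fun (u : U) (v : V) => u \ox (v \ox w)).
Proof.
by split=> [v a u u'|u a v v']; rewrite !((tens_bilinear _ _).1,
  (tens_bilinear _ _).2).
Qed.

Fact tassoc_bilinear :
  bilinear_for *:%R *:%R (fun t w => tlift (tassoc_inner_bilinear w) t).
Proof.
split=> [w a t t'|t a w w']; first by rewrite linearP.
suff: tlift (tassoc_inner_bilinear (a *: w + w')) t =
  a *: tlift (tassoc_inner_bilinear w) t + tlift (tassoc_inner_bilinear w') t.
  by [].
elim/tensor_ind: t => [|b u v t IHt]; first by rewrite !linear0 addr0.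
rewrite !linearP !tliftE IHt !(tens_bilinear _ _).2 !scalerDr !scalerA.
by rewrite addrACA [b * a]mulrC.
Qed.

Definition tassoc : {linear tensor (tensor U V) W -> tensor U (tensor V W)} :=
  tlift tassoc_bilinear.

Lemma tassocE u v w : tassoc (u \ox v \ox w) = u \ox (v \ox w).
Proof. by rewrite /tassoc !tliftE. Qed.
End Assoc.

Section Unit.
Variable U : lmodType F.

Fact lunit_bilinear : bilinear_for *:%R *:%R (fun (a : F^o) (u : U) => a *: u).
Proof.
split=> [u a b b'|b a u u'] /=; first by rewrite scalerDl scalerA.
by rewrite scalerDr !scalerA mulrC.
Qed.
Fact runit_bilinear : bilinear_for *:%R *:%R (fun (u : U) (a : F^o) => a *: u).
Proof. by split; [exact: lunit_bilinear.2|exact: lunit_bilinear.1]. Qed.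

Definition lunit : {linear tensor F^o U -> U} := tlift lunit_bilinear.
Definition runit : {linear tensor U F^o -> U} := tlift runit_bilinear.

Lemma lunitE (a : F^o) u : lunit (a \ox u) = a *: u. Proof. exact: tliftE. Qed.
Lemma runitE u (a : F^o) : runit (u \ox a) = a *: u. Proof. exact: tliftE. Qed.
End Unit.

End TensorMaps.

Notation "f \otL g" := (tmap f g) (at level 40, left associativity) : ring_scope.
Arguments tassoc {F} U V W.
Arguments lunit {F} U.
Arguments runit {F} U.

Record coalgebra (F : fieldType) := Coalgebra {
  coalg_sort :> lmodType F;
  comul : {linear coalg_sort -> tensor coalg_sort coalg_sort};
  comulA : (lid _ \otL comul) \oL comul
           = tassoc _ _ _ \oL (comul \otL lid _) \oL comul }.
Arguments comul {F} c.

Definition is_coderivation (F : fieldType) (C : coalgebra F)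
    (psi : {linear C -> C}) :=
  comul C \oL psi = (psi \otL lid C) \oL comul C + (lid C \otL psi) \oL comul C.

Record coderPair (F : fieldType) := CoderPair {
  coder_coalg :> coalgebra F;
  coder : {linear coder_coalg -> coder_coalg};
  coderP : is_coderivation coder }.
Arguments coder {F} c.

Record bicomodule (F : fieldType) (C : coalgebra F) := Bicomodule {
  bicomod_sort :> lmodType F;
  lcoact : {linear bicomod_sort -> tensor C bicomod_sort};
  rcoact : {linear bicomod_sort -> tensor bicomod_sort C};
  lcoactA : tassoc _ _ _ \oL (comul C \otL lid _) \oL lcoact
            = (lid C \otL lcoact) \oL lcoact;
  rcoactA : (lid _ \otL comul C) \oL rcoact
            = tassoc _ _ _ \oL (rcoact \otL lid C) \oL rcoact;
  lrcoactA : (lid C \otL rcoact) \oL lcoact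
             = tassoc _ _ _ \oL (lcoact \otL lid C) \oL rcoact }.
Arguments lcoact {F C} b.
Arguments rcoact {F C} b.

Record coderBicomodule (F : fieldType) (C : coderPair F) := CoderBicomodule {
  cbm_bicomod :> bicomodule C;
  cbm_map : {linear cbm_bicomod -> cbm_bicomod};
  cbm_lcoact : lcoact cbm_bicomod \oL cbm_map
    = (lid C \otL cbm_map) \oL lcoact cbm_bicomod
      + (coder C \otL lid _) \oL lcoact cbm_bicomod;
  cbm_rcoact : rcoact cbm_bicomod \oL cbm_map
    = (cbm_map \otL lid C) \oL rcoact cbm_bicomod
      + (lid _ \otL coder C) \oL rcoact cbm_bicomod }.
Arguments cbm_map {F C} c.

Section TensorPowers.
Variables (F : fieldType) (C : lmodType F).

(* tpowS n is the (n+1)-st tensor power C (x) (C (x) (... (x) C)). *)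
Fixpoint tpowS (n : nat) : lmodType F :=
  if n is n'.+1 then tensor C (tpowS n') else C.

Definition tpow (n : nat) : lmodType F :=
  if n is n'.+1 then tpowS n' else F^o.

(* C (x) C^(x)n = C^(x)(n+1) *)
Definition tpow_consl (n : nat) : {linear tensor C (tpow n) -> tpow n.+1} :=
  match n with
  | 0 => runit C
  | n'.+1 => lid (tensor C (tpowS n'))
  end.

(* C^(x)n (x) C = C^(x)(n+1) *)
Fixpoint tpowS_consr (n : nat) : {linear tensor (tpowS n) C -> tpowS n.+1} :=
  match n with
  | 0 => lid (tensor C C)
  | n'.+1 => (lid C \otL tpowS_consr n') \oL tassoc C (tpowS n') C
  end.

Definition tpow_consr (n : nat) : {linear tensor (tpow n) C -> tpow n.+1} :=
  match n with
  | 0 => lunit C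
  | n'.+1 => tpowS_consr n'
  end.

(* Id_{C^(x)i} (x) phi (x) Id_{C^(x)(n-i)} on C^(x)(n+1), for i <= n; the
   value 0 for i > n is never used. *)
Fixpoint tpowS_at (phi : {linear C -> C}) (n i : nat) :
    {linear tpowS n -> tpowS n} :=
  match n, i with
  | 0, 0 => phi
  | 0, _.+1 => 0
  | n'.+1, 0 => phi \otL lid (tpowS n')
  | n'.+1, i'.+1 => lid C \otL tpowS_at phi n' i'
  end.

Definition tpow_at (phi : {linear C -> C}) (n i : nat) :
    {linear tpow n -> tpow n} :=
  match n with 0 => 0 | n'.+1 => tpowS_at phi n' i end.

(* Id_{C^(x)i} (x) D (x) Id_{C^(x)(n-i)} : C^(x)(n+1) -> C^(x)(n+2), likewise. *)
Fixpoint tpowS_split (D : {linear C -> tensor C C}) (n i : nat) :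
    {linear tpowS n -> tpowS n.+1} :=
  match n, i with
  | 0, 0 => D
  | 0, _.+1 => 0
  | n'.+1, 0 => tassoc C C (tpowS n') \oL (D \otL lid (tpowS n'))
  | n'.+1, i'.+1 => lid C \otL tpowS_split D n' i'
  end.

Definition tpow_split (D : {linear C -> tensor C C}) (n i : nat) :
    {linear tpow n -> tpow n.+1} :=
  match n with 0 => 0 | n'.+1 => tpowS_split D n' i end.

End TensorPowers.

Section Cochains.
Variables (F : fieldType) (C : coderPair F) (M : coderBicomodule C).

Definition cochain (n : nat) : lmodType F := {linear M -> tpow C n}.

(* The index i : 'I_n is 0-based, hence the sign (-1)^(i+1). *)
Definition delta_c (n : nat) (f : cochain n) : cochain n.+1 :=
  tpow_consl C n \oL (lid C \otL f) \oL lcoact M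
  + \sum_(i < n) (-1) ^+ i.+1 *: (tpow_split (comul C) n i \oL f)
  + (-1) ^+ n.+1 *: (tpow_consr C n \oL (f \otL lid C) \oL rcoact M).

Definition omega (n : nat) (f : cochain n) : cochain n :=
  \sum_(i < n) (tpow_at (coder C) n i \oL f) - f \oL cbm_map M.

(* 'rV[F]_0 is the zero space. *)
Definition coder_cochain (n : nat) : lmodType F :=
  match n with
  | 0 => 'rV[F]_0
  | 1 => {linear M -> C}
  | n'.+2 => (cochain n'.+2 * cochain n'.+1)%type
  end.

Definition coder_d (n : nat) : coder_cochain n -> coder_cochain n.+1 :=
  match n with
  | 0 => fun=> 0
  | 1 => fun f => (delta_c (f : cochain 1), - omega (f : cochain 1))
  | n'.+2 => fun fg : cochain n'.+2 * cochain n'.+1 =>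
      (delta_c fg.1, delta_c fg.2 + (-1) ^+ n'.+2 *: omega fg.1)
  end.

End Cochains.

(* Main.v *)
(* On [C^(x)n], let [D_n] be the signed sum of the [n] maps applying [Delta]
   to one factor, [T_n] the sum of the [n] maps applying [psi_C] to one factor,
   and [r_n] the identification [C^(x)n (x) C = C^(x)(n+1)].  Induction on [n],
   peeling off the first factor, gives [D_(n+1) D_n = 0] (coassociativity),
   [D_n T_n = T_(n+1) D_n] (coderivation), and formulas for [D_(n+1) r_n] and
   [T_(n+1) r_n].  Writing [delta_c f] as the left coaction term plus [D_n f]
   plus the signed right coaction term, the bicomodule axioms make
   [delta_c (delta_c f)] cancel, and the compatibility of [psi_M] with the
   coactions makes [omega] commute with [delta_c] term by term.  Both
   components of [d_c (d_c (f, g))] then vanish by linearity of [delta_c]. *)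
Require Import Defs.
From mathcomp Require Import all_boot all_algebra.

Set Implicit Arguments.
Unset Strict Implicit.
Unset Printing Implicit Defensive.

Import GRing.Theory.
Local Open Scope ring_scope.

(* On the concrete tensor product, unification unfolds the quotient of the free
   module; the algebra is therefore done over an arbitrary model of these
   laws. *)
Record tensor_model (F : fieldType) := TensorModel {
  tm_obj : lmodType F -> lmodType F -> lmodType F;
  tm_pure : forall U V : lmodType F, U -> V -> tm_obj U V;
  tm_bilinear : forall U V : lmodType F,
    bilinear_for *:%R *:%R (@tm_pure U V);
  tm_ext : forall (U V W : lmodType F) (f g : {linear tm_obj U V -> W}),
    (forall u v, f (tm_pure u v) = g (tm_pure u v)) -> f = g;
  tm_map : forall U V U' V' : lmodType F,
    {linear U -> U'} -> {linear V -> V'} -> {linear tm_obj U V -> tm_obj U' V'};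
  tm_mapE : forall (U V U' V' : lmodType F) (f : {linear U -> U'})
    (g : {linear V -> V'}) u v, tm_map f g (tm_pure u v) = tm_pure (f u) (g v);
  tm_assoc : forall U V W : lmodType F,
    {linear tm_obj (tm_obj U V) W -> tm_obj U (tm_obj V W)};
  tm_assocE : forall (U V W : lmodType F) (u : U) (v : V) (w : W),
    tm_assoc U V W (tm_pure (tm_pure u v) w) = tm_pure u (tm_pure v w) }.
Arguments tm_pure {F} t {U V}.
Arguments tm_map {F} t {U V U' V'}.
Arguments tm_assoc {F} t U V W.

Definition concrete_tensor (F : fieldType) : tensor_model F :=
  TensorModel (@tens_bilinear F) (@tensor_lin_eq F) (@tmapE F) (@tassocE F).

(** * Calculus of pure tensors and of maps between tensor products *)

Section TensorModel.
Variables (F : fieldType) (X : tensor_model F).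
Implicit Types U V W Z : lmodType F.
Local Notation tensor := (tm_obj X).
Local Notation "u \ox v" := (tm_pure X u v) : ring_scope.
Local Notation "f \otL g" := (tm_map X f g) : ring_scope.
Local Notation tassoc := (tm_assoc X).

Lemma pureDl U V (u u' : U) (v : V) : (u + u') \ox v = u \ox v + u' \ox v.
Proof. by have := (tm_bilinear X U V).1 v 1 u u'; rewrite /= !scale1r. Qed.

Lemma pureDr U V (u : U) (v v' : V) : u \ox (v + v') = u \ox v + u \ox v'.
Proof. by have := (tm_bilinear X U V).2 u 1 v v'; rewrite /= !scale1r. Qed.

Lemma pure0l U V (v : V) : (0 : U) \ox v = 0.
Proof. by apply: (addrI (0 \ox v)); rewrite -pureDl !addr0. Qed.

Lemma pure0r U V (u : U) : u \ox (0 : V) = 0.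
Proof. by apply: (addrI (u \ox 0)); rewrite -pureDr !addr0. Qed.

Lemma pureZl U V a (u : U) (v : V) : (a *: u) \ox v = a *: (u \ox v).
Proof.
by have := (tm_bilinear X U V).1 v a u 0; rewrite /= !addr0 pure0l addr0.
Qed.

Lemma pureZr U V a (u : U) (v : V) : u \ox (a *: v) = a *: (u \ox v).
Proof.
by have := (tm_bilinear X U V).2 u a v 0; rewrite /= !addr0 pure0r addr0.
Qed.

Lemma pureNl U V (u : U) (v : V) : (- u) \ox v = - (u \ox v).
Proof. by rewrite -scaleN1r pureZl scaleN1r. Qed.

Fact pure_right_linear U V (v : V) : linear (fun u : U => u \ox v).
Proof. by move=> a u u'; rewrite pureDl pureZl. Qed.
(** Composing with this map freezes the last factor: an identity about [t \ox v] becomes an equality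
    of linear maps in [t], which can be tested on pure tensors. *)
Definition pure_right U V (v : V) : {linear U -> tensor U V} :=
  mklinear (@pure_right_linear U V v).

Lemma pure_rightE U V (u : U) (v : V) : pure_right U v u = u \ox v.
Proof. by []. Qed.

Lemma tensor_ext U V W (f g : {linear tensor U V -> W}) t :
  (forall u v, f (u \ox v) = g (u \ox v)) -> f t = g t.
Proof. by move=> /tm_ext ->. Qed.

Lemma tensor_ext3 U V W Z (f g : {linear tensor (tensor U V) W -> Z}) t :
  (forall u v w, f (u \ox v \ox w) = g (u \ox v \ox w)) -> f t = g t.
Proof.
move=> efg; apply: tensor_ext => s w.
exact: (@tensor_ext _ _ _ (f \oL pure_right _ w) (g \oL pure_right _ w) s
  (fun u v => efg u v w)).
Qed.

Lemma tmap_comp U V U' V' U'' V'' (f' : {linear U' -> U''})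
    (g' : {linear V' -> V''}) (f : {linear U -> U'}) (g : {linear V -> V'}) t :
  (f' \otL g') ((f \otL g) t) = ((f' \oL f) \otL (g' \oL g)) t.
Proof.
apply: (@tensor_ext _ _ _ ((f' \otL g') \oL (f \otL g))
  ((f' \oL f) \otL (g' \oL g))) => u v.
by rewrite lcompE !tm_mapE.
Qed.

Lemma tmap_compl U V U' U'' (f' : {linear U' -> U''}) (f : {linear U -> U'}) t :
  (f' \otL lid V) ((f \otL lid V) t) = ((f' \oL f) \otL lid V) t.
Proof. by rewrite tmap_comp; congr (tm_map X _ _ _); apply: linearP_eq. Qed.

Lemma tmap_compr U V V' V'' (g' : {linear V' -> V''}) (g : {linear V -> V'}) t :
  (lid U \otL g') ((lid U \otL g) t) = (lid U \otL (g' \oL g)) t.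
Proof. by rewrite tmap_comp; congr (tm_map X _ _ _); apply: linearP_eq. Qed.

Lemma tmap_exchange U V U' V' (f : {linear U -> U'}) (g : {linear V -> V'}) t :
  (f \otL lid V') ((lid U \otL g) t) = (lid U' \otL g) ((f \otL lid V) t).
Proof. by rewrite !tmap_comp; congr (tm_map X _ _ _); apply: linearP_eq. Qed.

Lemma tmap_id U V (t : tensor U V) : (lid U \otL lid V) t = t.
Proof.
apply: (@tensor_ext _ _ _ (lid U \otL lid V) (lid _)) => u v.
by rewrite tm_mapE.
Qed.

Lemma tmapDl U V U' V' (f g : {linear U -> U'}) (h : {linear V -> V'}) t :
  ((f + g) \otL h) t = (f \otL h) t + (g \otL h) t.
Proof.
apply: (@tensor_ext _ _ _ ((f + g) \otL h) ((f \otL h) + (g \otL h))) => u v.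
by rewrite lin_addE !tm_mapE pureDl.
Qed.

Lemma tmapDr U V U' V' (h : {linear U -> U'}) (f g : {linear V -> V'}) t :
  (h \otL (f + g)) t = (h \otL f) t + (h \otL g) t.
Proof.
apply: (@tensor_ext _ _ _ (h \otL (f + g)) ((h \otL f) + (h \otL g))) => u v.
by rewrite lin_addE !tm_mapE pureDr.
Qed.

Lemma tmapZl U V U' V' a (f : {linear U -> U'}) (h : {linear V -> V'}) t :
  ((a *: f) \otL h) t = a *: (f \otL h) t.
Proof.
apply: (@tensor_ext _ _ _ ((a *: f) \otL h) (a *: (f \otL h))) => u v.
by rewrite lin_scaleE !tm_mapE pureZl.
Qed.

Lemma tmapZr U V U' V' a (h : {linear U -> U'}) (f : {linear V -> V'}) t :
  (h \otL (a *: f)) t = a *: (h \otL f) t.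
Proof.
apply: (@tensor_ext _ _ _ (h \otL (a *: f)) (a *: (h \otL f))) => u v.
by rewrite lin_scaleE !tm_mapE pureZr.
Qed.

Lemma tmapNl U V U' V' (f : {linear U -> U'}) (h : {linear V -> V'}) t :
  ((- f) \otL h) t = - (f \otL h) t.
Proof. by rewrite -[- f]scaleN1r tmapZl scaleN1r. Qed.

Lemma tmapNr U V U' V' (h : {linear U -> U'}) (f : {linear V -> V'}) t :
  (h \otL (- f)) t = - (h \otL f) t.
Proof. by rewrite -[- f]scaleN1r tmapZr scaleN1r. Qed.

Lemma tmap0r U V U' V' (h : {linear U -> U'}) t :
  (h \otL (0 : {linear V -> V'})) t = 0.
Proof. by rewrite -[0 in LHS](scale0r 0) tmapZr scale0r. Qed.

Lemma tmap_sumr U V U' V' (h : {linear U -> U'}) I (r : seq I) (P : pred I)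
    (G : I -> {linear V -> V'}) t :
  (h \otL (\sum_(i <- r | P i) G i)) t = \sum_(i <- r | P i) (h \otL G i) t.
Proof.
by elim/big_rec2: _ => [|i y f _ <-]; [exact: tmap0r | rewrite tmapDr].
Qed.

Lemma tassoc_nat U V W U' V' W' (f : {linear U -> U'}) (g : {linear V -> V'})
    (h : {linear W -> W'}) t :
  tassoc U' V' W' (((f \otL g) \otL h) t)
  = (f \otL (g \otL h)) (tassoc U V W t).
Proof.
apply: (@tensor_ext3 _ _ _ _ (tassoc U' V' W' \oL ((f \otL g) \otL h))
  ((f \otL (g \otL h)) \oL tassoc U V W)) => u v w.
by rewrite !lcompE tm_assocE !tm_mapE tm_assocE.
Qed.

(** Mac Lane's pentagon at [t \ox w \ox z]. Only [t] need not be pure, since it will be a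
    coproduct. *)
Lemma tassoc_pentagon U V W Z (t : tensor U V) (w : W) (z : Z) :
  (lid U \otL tassoc V W Z)
    (tassoc U (tensor V W) Z (tassoc U V W (t \ox w) \ox z))
  = tassoc U V (tensor W Z) (t \ox (w \ox z)).
Proof.
apply: (@tensor_ext _ _ _
  ((lid U \otL tassoc V W Z) \oL tassoc U (tensor V W) Z
   \oL pure_right _ z \oL tassoc U V W \oL pure_right _ w)
  (tassoc U V (tensor W Z) \oL pure_right _ (w \ox z))) => u v.
by rewrite !lcompE !pure_rightE !tm_assocE tm_mapE tm_assocE.
Qed.

(** * Inductive steps for maps on tensor powers, adding one factor in front *)

Section Comultiplication.
Variables (C : lmodType F) (Delta : {linear C -> tensor C C}).

Definition comull V : {linear tensor C V -> tensor C (tensor C V)} :=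
  tassoc C C V \oL (Delta \otL lid V).

Lemma comullE V c (v : V) : comull V (c \ox v) = tassoc C C V (Delta c \ox v).
Proof. by rewrite lcompE tm_mapE. Qed.

Lemma comull_nat V W (g : {linear V -> W}) t :
  comull W ((lid C \otL g) t) = (lid C \otL (lid C \otL g)) (comull V t).
Proof.
apply: (@tensor_ext _ _ _ (comull W \oL (lid C \otL g))
  ((lid C \otL (lid C \otL g)) \oL comull V)) => c v.
by rewrite 2!lcompE tm_mapE !comullE -tassoc_nat tm_mapE tmap_id.
Qed.

(* If [D] is the signed sum of the splittings of one factor of [C^(x)n], then
   [cobar_step D] is the one for [C^(x)(n+1)]: shifting the factors by one
   changes the signs. *)
Definition cobar_step V (D : {linear V -> tensor C V}) :
    {linear tensor C V -> tensor C (tensor C V)} :=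
  - comull V - (lid C \otL D).

Lemma cobar_stepE V (D : {linear V -> tensor C V}) t :
  cobar_step D t = - comull _ t - (lid C \otL D) t.
Proof. by []. Qed.

Lemma cobar_step_pure V (D : {linear V -> tensor C V}) c v :
  cobar_step D (c \ox v) = - tassoc C C V (Delta c \ox v) - c \ox D v.
Proof. by rewrite cobar_stepE comullE tm_mapE. Qed.

(** If [r] appends [Z] at the right end of [V], this appends it at the right end of [C (x) V].
    Besides [Z = C], the case [Z = C (x) C] serves to append two factors at once. *)
Definition consr_step V W Z (r : {linear tensor V Z -> W}) :
    {linear tensor (tensor C V) Z -> tensor C W} :=
  (lid C \otL r) \oL tassoc C V Z.

Lemma consr_stepE V W Z (r : {linear tensor V Z -> W}) c v z :
  consr_step r (c \ox v \ox z) = c \ox r (v \ox z).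
Proof. by rewrite lcompE tm_assocE tm_mapE. Qed.

Lemma consr_step_tassoc V W Z (r : {linear tensor V Z -> W}) s v z :
  consr_step (consr_step r) (tassoc C C V (s \ox v) \ox z)
  = tassoc C C W (s \ox r (v \ox z)).
Proof.
apply: (@tensor_ext _ _ _
  (consr_step (consr_step r) \oL pure_right _ z \oL tassoc C C V
   \oL pure_right _ v)
  (tassoc C C W \oL pure_right _ (r (v \ox z)))) => c1 c2.
do 3!rewrite [LHS]lcompE; rewrite [RHS]lcompE 3!pure_rightE.
by rewrite !tm_assocE !consr_stepE.
Qed.

(** Here [P] appends two factors together, [r] and [r'] one by one; the new factor in front takes no
    part in either. *)
Lemma consr_step_comp V W W2 (r : {linear tensor V C -> W})
    (r' : {linear tensor W C -> W2})
    (P : {linear tensor V (tensor C C) -> W2}) :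
  (forall t, r' ((r \otL lid C) t) = P (tassoc V C C t)) ->
  forall t, consr_step r' ((consr_step r \otL lid C) t)
            = consr_step P (tassoc (tensor C V) C C t).
Proof.
move=> rr t.
(* The source is a fourfold tensor product: the last factor is split off first, then the other
   three. *)
apply: (@tensor_ext _ _ _ (consr_step r' \oL (consr_step r \otL lid C))
  (consr_step P \oL tassoc _ _ _)) => s y.
apply: (@tensor_ext3 _ _ _ _
  (consr_step r' \oL (consr_step r \otL lid C) \oL pure_right _ y)
  (consr_step P \oL tassoc _ _ _ \oL pure_right _ y)) => c v x.
have := rr (v \ox x \ox y); rewrite tm_mapE tm_assocE => E.
rewrite [LHS]lcompE [RHS]lcompE pure_rightE [LHS]lcompE [RHS]lcompE.
by rewrite tm_mapE tm_assocE !consr_stepE E.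
Qed.

(** On [c \ox v \ox x] the terms with [Delta c] agree, and the others are [c] tensored with those of
    the hypothesis. The minus sign in [cobar_step] turns [s] into [- s]. *)
Lemma cobar_consr_step V (D : {linear V -> tensor C V})
    (r : {linear tensor V C -> tensor C V})
    (P : {linear tensor V (tensor C C) -> tensor C (tensor C V)}) (s : F) :
  (forall t, cobar_step D (r t)
     = consr_step r ((D \otL lid C) t) + s *: P ((lid V \otL Delta) t)) ->
  forall t, cobar_step (cobar_step D) (consr_step r t)
    = consr_step (consr_step r) ((cobar_step D \otL lid C) t)
      - s *: consr_step P ((lid (tensor C V) \otL Delta) t).
Proof.
move=> Dr t.
apply: (@tensor_ext3 _ _ _ _ (cobar_step (cobar_step D) \oL consr_step r)
  (consr_step (consr_step r) \oL (cobar_step D \otL lid C)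
   - s *: (consr_step P \oL (lid _ \otL Delta)))) => c v x.
rewrite lin_addE lin_oppE lin_scaleE [LHS]lcompE !(lcompE (consr_step _)).
rewrite !tm_mapE !cobar_step_pure !consr_stepE pureDl !pureNl.
rewrite (linearB (consr_step _)) (linearN (consr_step _)) consr_step_tassoc.
rewrite !consr_stepE cobar_step_pure Dr !tm_mapE pureDr pureZr opprD.
by rewrite addrA.
Qed.

Lemma consr_step_comp0 (t : tensor (tensor C C) C) :
  consr_step (lid (tensor C C)) ((lid (tensor C C) \otL lid C) t)
  = lid (tensor C (tensor C C)) (tassoc C C C t).
Proof. by rewrite tmap_id [LHS]tmap_id. Qed.

(** [cobar_step (- Delta)] is minus [Delta] on the first factor plus [Delta] on the second, appended
    one; hence the coefficient 1. *)
Lemma cobar_consr_step0 (t : tensor C C) :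
  cobar_step (- Delta) (lid (tensor C C) t)
  = consr_step (lid (tensor C C)) ((- Delta \otL lid C) t)
    + 1 *: lid (tensor C (tensor C C)) ((lid C \otL Delta) t).
Proof.
rewrite scale1r cobar_stepE tmapNl tmapNr opprK; congr (_ + _).
by rewrite (linearN (consr_step _)); congr (- _); exact: esym (tmap_id _).
Qed.

Lemma comull_coassoc V :
  (forall c, (lid C \otL Delta) (Delta c)
             = tassoc C C C ((Delta \otL lid C) (Delta c))) ->
  forall t, comull (tensor C V) (comull V t)
            = (lid C \otL comull V) (comull V t).
Proof.
move=> DeltaA t.
apply: (@tensor_ext _ _ _ (comull (tensor C V) \oL comull V)
  ((lid C \otL comull V) \oL comull V)) => c v.
(* [Y] attaches the spectator [v] to a threefold tensor and nests everything to the right. Both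
   sides are [Y] of one side of coassociativity; for the left one this is the pentagon. *)
pose Y := (lid C \otL tassoc C C V) \oL tassoc C (tensor C C) V
  \oL pure_right _ v.
have HL s : comull (tensor C V) (tassoc C C V (s \ox v))
    = Y (tassoc C C C ((Delta \otL lid C) s)).
  apply: (@tensor_ext _ _ _
    (comull (tensor C V) \oL tassoc C C V \oL pure_right _ v)
    (Y \oL tassoc C C C \oL (Delta \otL lid C))) => c1 c2.
  rewrite /Y 6!lcompE tm_mapE 2!pure_rightE tm_assocE comullE.
  by rewrite tassoc_pentagon.
have HR s : (lid C \otL comull V) (tassoc C C V (s \ox v))
    = Y ((lid C \otL Delta) s).
  apply: (@tensor_ext _ _ _
    ((lid C \otL comull V) \oL tassoc C C V \oL pure_right _ v)
    (Y \oL (lid C \otL Delta))) => c1 c2.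
  rewrite /Y 5!lcompE 2!pure_rightE tm_assocE 2!tm_mapE tm_assocE tm_mapE.
  by rewrite comullE.
by rewrite 2!lcompE !comullE HL HR DeltaA.
Qed.

Hypothesis DeltaA : forall c, (lid C \otL Delta) (Delta c)
                              = tassoc C C C ((Delta \otL lid C) (Delta c)).

Lemma cobar_step_step0 c : cobar_step (- Delta) ((- Delta) c) = 0.
Proof.
rewrite lin_oppE (linearN (cobar_step _)) cobar_stepE tmapNr DeltaA.
by rewrite opprK addNr oppr0.
Qed.

(** In the expansion, the terms with two [comull] cancel by coassociativity, those with one [comull]
    and one [D] cancel by naturality, and the rest vanishes by hypothesis. *)
Lemma cobar_step_step V (D : {linear V -> tensor C V}) :
  (forall v, cobar_step D (D v) = 0) ->
  forall t, cobar_step (cobar_step D) (cobar_step D t) = 0.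
Proof.
move=> D2 t; have {}D2 : (lid C \otL cobar_step D) ((lid C \otL D) t) = 0.
  rewrite tmap_comp; have -> : cobar_step D \oL D = 0.
    by apply: linearP_eq => s; rewrite lcompE D2.
  exact: tmap0r.
rewrite cobar_stepE [cobar_step D t]cobar_stepE.
rewrite (linearB (comull _)) (linearN (comull _)) comull_nat comull_coassoc //.
rewrite (linearB (lid C \otL cobar_step D)) D2 subr0.
rewrite (linearN (lid C \otL cobar_step D)) opprK tmapDr !tmapNr.
by rewrite addNr.
Qed.

(** * Extension of a coderivation to tensor powers *)

Section Coderivation.
Variable psi : {linear C -> C}.

(** If [T] is the sum of [psi] over the factors of [C^(x)n], this is that sum on [C^(x)(n+1)]. For
    [T = psi] it is the operator in the coderivation identity. *)
Definition leibniz V (T : {linear V -> V}) :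
    {linear tensor C V -> tensor C V} :=
  (psi \otL lid V) + (lid C \otL T).

Lemma leibniz_pure V (T : {linear V -> V}) c v :
  leibniz T (c \ox v) = psi c \ox v + c \ox T v.
Proof. by rewrite lin_addE 2!tm_mapE. Qed.

(** The first two factors may be grouped together; [s] is arbitrary because it will be [Delta c]. *)
Lemma leibniz_tassoc V (T : {linear V -> V}) s v :
  leibniz (leibniz T) (tassoc C C V (s \ox v))
  = tassoc C C V (leibniz psi s \ox v) + tassoc C C V (s \ox T v).
Proof.
apply: (@tensor_ext _ _ _
  (leibniz (leibniz T) \oL tassoc C C V \oL pure_right _ v)
  ((tassoc C C V \oL pure_right _ v \oL leibniz psi)
   + (tassoc C C V \oL pure_right _ (T v)))) => c1 c2.
rewrite lin_addE 5!lcompE 3!pure_rightE !tm_assocE 3!leibniz_pure pureDl.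
by rewrite (linearD (tassoc _ _ _)) !tm_assocE pureDr addrA.
Qed.

Lemma leibniz_consr_step V W (T : {linear V -> V}) (T' : {linear W -> W})
    (r : {linear tensor V C -> W}) :
  (forall t, T' (r t) = r ((T \otL lid C) t) + r ((lid V \otL psi) t)) ->
  forall t, leibniz T' (consr_step r t)
    = consr_step r ((leibniz T \otL lid C) t)
      + consr_step r ((lid (tensor C V) \otL psi) t).
Proof.
move=> Tr t; apply: (@tensor_ext3 _ _ _ _ (leibniz T' \oL consr_step r)
  (consr_step r \oL (leibniz T \otL lid C)
    + consr_step r \oL (lid _ \otL psi))) => c v x.
rewrite lin_addE [LHS]lcompE !(lcompE (consr_step _)) !tm_mapE consr_stepE.
rewrite !leibniz_pure Tr !tm_mapE pureDl (linearD (consr_step _)) !consr_stepE.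
by rewrite !pureDr addrA.
Qed.

Hypothesis psiP : forall c, Delta (psi c) = leibniz psi (Delta c).

(** The coderivation identity moves [psi] through [Delta] on the first factor, and [T] acts where
    [Delta] does not. *)
Lemma comull_leibniz V (T : {linear V -> V}) t :
  comull V (leibniz T t) = leibniz (leibniz T) (comull V t).
Proof.
apply: (@tensor_ext _ _ _ (comull V \oL leibniz T)
  (leibniz (leibniz T) \oL comull V)) => c v.
rewrite 2!lcompE leibniz_pure (linearD (comull _)) 3!comullE leibniz_tassoc.
by rewrite psiP.
Qed.

Lemma cobar_leibniz_step V (D : {linear V -> tensor C V})
    (T : {linear V -> V}) :
  (forall v, D (T v) = leibniz T (D v)) ->
  forall t, cobar_step D (leibniz T t) = leibniz (leibniz T) (cobar_step D t).
Proof.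
move=> DT t; rewrite 2!cobar_stepE comull_leibniz.
rewrite (linearB (leibniz _)) (linearN (leibniz _)); congr (_ - _).
apply: (@tensor_ext _ _ _ ((lid C \otL D) \oL leibniz T)
  (leibniz (leibniz T) \oL (lid C \otL D))) => c s.
rewrite 2!lcompE leibniz_pure (linearD (lid C \otL D)) !tm_mapE leibniz_pure.
by rewrite DT.
Qed.

End Coderivation.

(** * Hochschild coboundary and coderivation commutator for a bicomodule *)

Section Bicomodule.
Variables (M : lmodType F).
Variables (rl : {linear M -> tensor C M}) (rr : {linear M -> tensor M C}).
Implicit Types (x : M).

Definition lact V (f : {linear M -> V}) : {linear M -> tensor C V} :=
  (lid C \otL f) \oL rl.

(** Powers of [C] are nested to the right, so an identification [r] is needed here but not in
    [lact]. *)
Definition ract V W (r : {linear tensor V C -> W}) (f : {linear M -> V}) :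
    {linear M -> W} :=
  r \oL (f \otL lid C) \oL rr.

Lemma lactE V (f : {linear M -> V}) x : lact f x = (lid C \otL f) (rl x).
Proof. by []. Qed.

Lemma ractE V W (r : {linear tensor V C -> W}) (f : {linear M -> V}) x :
  ract r f x = r ((f \otL lid C) (rr x)).
Proof. by []. Qed.

(* For [V = C^(x)n], [D] stands for the signed sum of the splittings, [r] for
   the identification [C^(x)n (x) C = C^(x)(n+1)] and [s] for [(-1)^(n+1)]. *)
Definition hoch V (D : {linear V -> tensor C V})
    (r : {linear tensor V C -> tensor C V}) (s : F) (f : {linear M -> V}) :
    {linear M -> tensor C V} :=
  lact f + D \oL f + s *: ract r f.

Lemma hochE V (D : {linear V -> tensor C V}) r s (f : {linear M -> V}) x :
  hoch D r s f x = lact f x + D (f x) + s *: ract r f x.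
Proof. by []. Qed.

Lemma lact_linear V : linear (@lact V).
Proof.
move=> a f g; apply: linearP_eq => x.
by rewrite lin_addE lin_scaleE !lactE tmapDr tmapZr.
Qed.

Lemma ract_linear V W (r : {linear tensor V C -> W}) : linear (ract r).
Proof.
move=> a f g; apply: linearP_eq => x.
by rewrite lin_addE lin_scaleE !ractE tmapDl tmapZl (linearP r).
Qed.

Lemma hoch_linear V (D : {linear V -> tensor C V}) r s : linear (hoch D r s).
Proof.
move=> a f g; apply: linearP_eq => x.
rewrite -[RHS]/(a *: hoch D r s f x + hoch D r s g x) !hochE.
rewrite lact_linear ract_linear !lin_addE !lin_scaleE (linearP D).
rewrite !scalerDr !scalerA [s * a]mulrC.
by rewrite (addrACA (a *: lact f x)) (addrACA (_ + a *: D (f x))).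
Qed.

Section Coboundary.
Hypothesis rlA : forall x, comull M (rl x) = (lid C \otL rl) (rl x).
Hypothesis rrA : forall x, (lid M \otL Delta) (rr x)
                           = tassoc M C C ((rr \otL lid C) (rr x)).
Hypothesis lrA : forall x, (lid C \otL rr) (rl x)
                           = tassoc C M C ((rl \otL lid C) (rr x)).

Lemma lact_lact V (f : {linear M -> V}) x :
  lact (lact f) x = comull V (lact f x).
Proof. by rewrite !lactE comull_nat rlA tmap_compr. Qed.

Lemma lact_comp V W (D : {linear V -> W}) (f : {linear M -> V}) x :
  lact (D \oL f) x = (lid C \otL D) (lact f x).
Proof. by rewrite !lactE tmap_compr. Qed.

Lemma ract_comp V W Z (r : {linear tensor V C -> W}) (D : {linear Z -> V})
    (f : {linear M -> Z}) x :
  ract r (D \oL f) x = r ((D \otL lid C) ((f \otL lid C) (rr x))).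
Proof. by rewrite ractE tmap_compl. Qed.

(** The two orders of coacting agree by [lrA], up to an associator, across which naturality carries
    [f]. *)
Lemma lact_ract V W (r : {linear tensor V C -> W}) (f : {linear M -> V}) x :
  lact (ract r f) x = ract (consr_step r) (lact f) x.
Proof.
rewrite ractE lactE /lact /ract -tmap_compl -!tmap_compr lrA.
by rewrite -[consr_step _ _]/((lid C \otL r) (tassoc _ _ _ _)) tassoc_nat.
Qed.

(** By [rrA], coacting twice on the right is coacting once and then applying [Delta] to the new
    factor. *)
Lemma ract_ract V W W2 (r : {linear tensor V C -> W})
    (r' : {linear tensor W C -> W2}) (P : {linear tensor V (tensor C C) -> W2})
    (f : {linear M -> V}) x :
  (forall t, r' ((r \otL lid C) t) = P (tassoc V C C t)) ->
  ract r' (ract r f) x = P ((lid V \otL Delta) ((f \otL lid C) (rr x))).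
Proof.
move=> r'r; rewrite ractE /ract -!tmap_compl r'r tassoc_nat -rrA !tmap_comp.
congr (P (tm_map X _ _ _)); apply: linearP_eq => // c.
by rewrite !lcompE tmap_id.
Qed.

(** Of the nine terms, [lact (lact f)] and [lact (D \oL f)] cancel [cobar_step D] of [lact f];
    [cobar_step D] after [D] is 0; the mixed coaction terms cancel by [lact_ract]; and
    [cobar_step D] of [ract r f] cancels the last two by [Dr] and [ract_ract]. *)
Lemma hoch_hoch V (D : {linear V -> tensor C V})
    (r : {linear tensor V C -> tensor C V})
    (P : {linear tensor V (tensor C C) -> tensor C (tensor C V)}) (s : F)
    (f : {linear M -> V}) :
  (forall v, cobar_step D (D v) = 0) ->
  (forall t, consr_step r ((r \otL lid C) t) = P (tassoc V C C t)) ->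
  (forall t, cobar_step D (r t)
     = consr_step r ((D \otL lid C) t) + s *: P ((lid V \otL Delta) t)) ->
  hoch (cobar_step D) (consr_step r) (- s) (hoch D r s f) = 0.
Proof.
move=> D2 rrP Dr; apply: linearP_eq => x; rewrite hochE.
have -> : lact (hoch D r s f) x
    = lact (lact f) x + lact (D \oL f) x + s *: lact (ract r f) x.
  by rewrite !lactE !tmapDr tmapZr.
have -> : ract (consr_step r) (hoch D r s f) x = ract (consr_step r) (lact f) x
    + ract (consr_step r) (D \oL f) x + s *: ract (consr_step r) (ract r f) x.
  rewrite !ractE !tmapDl tmapZl !(linearD (consr_step r)).
  by rewrite (linearZZ (consr_step r)).
rewrite hochE !(linearD (cobar_step D)) (linearZZ (cobar_step D)) D2 addr0.
rewrite lact_lact lact_comp lact_ract (ract_ract _ _ rrP) ract_comp Dr.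
rewrite cobar_stepE -opprD scaleNr -(addrA (ract _ _ _)) addrACA subrr add0r.
by rewrite -scalerDr subrr.
Qed.

End Coboundary.

Section Coderivation.
Variables (psi : {linear C -> C}) (psiM : {linear M -> M}).
Hypothesis rlM : forall x, rl (psiM x)
  = (lid C \otL psiM) (rl x) + (psi \otL lid M) (rl x).
Hypothesis rrM : forall x, rr (psiM x)
  = (psiM \otL lid C) (rr x) + (lid M \otL psi) (rr x).

Definition coder_comm V (T : {linear V -> V}) (f : {linear M -> V}) :
    {linear M -> V} := T \oL f - f \oL psiM.

Lemma hoch_coder_comm V (D : {linear V -> tensor C V})
    (r : {linear tensor V C -> tensor C V}) s (T : {linear V -> V})
    (f : {linear M -> V}) :
  (forall v, D (T v) = leibniz psi T (D v)) ->
  (forall t, leibniz psi T (r t)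
     = r ((T \otL lid C) t) + r ((lid V \otL psi) t)) ->
  hoch D r s (coder_comm T f) = coder_comm (leibniz psi T) (hoch D r s f).
Proof.
move=> DT Tr; apply: linearP_eq => x.
(* The contributions [psi (x) f], one from [leibniz] and one from [rlM], cancel. *)
have lactT : lact (coder_comm T f) x
    = leibniz psi T (lact f x) - lact f (psiM x).
  rewrite !lactE rlM tmapDr tmapNr.
  rewrite -[leibniz _ _ _]/((_ \otL _) _ + (_ \otL _) _).
  rewrite (linearD (lid C \otL f)) !tmap_compr tmap_exchange.
  by rewrite [X in _ = _ - X]addrC [X in _ = X - _]addrC addrKA.
(* Likewise the contributions [f (x) psi] from [Tr] and [rrM] cancel. *)
have ractT : ract r (coder_comm T f) x
    = leibniz psi T (ract r f x) - ract r f (psiM x).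
  rewrite !ractE Tr rrM tmapDl tmapNl (linearB r).
  rewrite (linearD (f \otL lid C)) (linearD r) !tmap_compl tmap_exchange.
  by rewrite [- (_ + _)]opprD addrACA subrr addr0.
rewrite -[RHS]/(leibniz psi T (hoch D r s f x) - hoch D r s f (psiM x)).
rewrite !hochE !(linearD (leibniz psi T)) (linearZZ (leibniz psi T)).
rewrite lactT ractT -[coder_comm T f x]/(T (f x) - f (psiM x)) (linearB D).
rewrite DT scalerBr !opprD (addrACA (leibniz _ _ (lact f x))).
by rewrite (addrACA (_ + leibniz _ _ (D (f x)))).
Qed.

End Coderivation.
End Bicomodule.
End Comultiplication.
End TensorModel.

(** * The signed splitting operator on the powers of [C] *)

Section TensorPowers.
Variables (F : fieldType) (C : coalgebra F).
Local Notation X := (concrete_tensor F).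

(** Index [m] means [m + 1] factors; the complex has no nonzero component with values in the zeroth
    power. The recursion lets the step lemmas apply by conversion. *)
Fixpoint cobar (m : nat) : {linear tpowS C m -> tpowS C m.+1} :=
  match m with
  | 0 => - comul C
  | m'.+1 => cobar_step (X := X) (comul C) (cobar m')
  end.

(** Appending a pair at once expresses [Delta] on the last factor without opening the nested
    power. *)
Fixpoint consr2 (m : nat) :
    {linear tensor (tpowS C m) (tensor C C) -> tpowS C m.+2} :=
  match m return {linear tensor (tpowS C m) (tensor C C) -> tpowS C m.+2} with
  | 0 => lid (tensor C (tensor C C))
  | m'.+1 => consr_step (X := X) C (consr2 m')
  end.

Lemma cobar_sum m :
  cobar m = \sum_(i < m.+1) (-1) ^+ i.+1 *: tpowS_split (comul C) m i.
Proof.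
elim: m => [|m IHm]; first by rewrite big_ord1 scaleN1r.
apply: linearP_eq => t; rewrite lin_sumE big_ord_recl.
rewrite -[cobar m.+1 t]/(- comull (X := X) (comul C) _ t
                         - (lid C \otL cobar m) t).
congr (_ + _); first by rewrite scaleN1r.
rewrite IHm (tmap_sumr (X := X)) -sumrN; apply: eq_bigr => i _.
by rewrite (tmapZr (X := X)) -scaleNr -mulN1r -exprS.
Qed.

Lemma comulAE c : (lid C \otL comul C) (comul C c)
                  = tassoc C C C ((comul C \otL lid C) (comul C c)).
Proof. by have /(congr1 (fun h : {linear _ -> _} => h c)) := comulA C. Qed.

Lemma cobar_cobar m t : cobar m.+1 (cobar m t) = 0.
Proof.
elim: m t => [|m IHm] t; first exact: (cobar_step_step0 (X := X) comulAE t).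
exact: (cobar_step_step (X := X) comulAE IHm t).
Qed.

Lemma consr_consr m t :
  tpowS_consr C m.+1 ((tpowS_consr C m \otL lid C) t)
  = consr2 m (tassoc (tpowS C m) C C t).
Proof.
elim: m t => [|m IHm] t; first exact: (consr_step_comp0 (X := X) t).
exact: (consr_step_comp (X := X) IHm t).
Qed.

(* Splitting the last factor of [C^(x)(m+1) (x) C] is the only term of
   [cobar m.+1] that [cobar m] does not see. *)
Lemma cobar_consr m t :
  cobar m.+1 (tpowS_consr C m t)
  = tpowS_consr C m.+1 ((cobar m \otL lid C) t)
    + (-1) ^+ m *: consr2 m ((lid (tpowS C m) \otL comul C) t).
Proof.
elim: m t => [|m IHm] t; first exact: (cobar_consr_step0 (X := X) (comul C) t).
rewrite exprS mulN1r scaleNr.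
exact: (cobar_consr_step (X := X) IHm t).
Qed.

End TensorPowers.

(** * The coderivation on the powers, and [delta_c] and [omega] on cochains *)

Section Coderivation.
Variables (F : fieldType) (C : coderPair F).
Local Notation X := (concrete_tensor F).

Fixpoint tder (m : nat) : {linear tpowS C m -> tpowS C m} :=
  match m with
  | 0 => coder C
  | m'.+1 => leibniz X (coder C) (tder m')
  end.

Lemma tder_sum m : tder m = \sum_(i < m.+1) tpowS_at (coder C) m i.
Proof.
elim: m => [|m IHm]; first by rewrite big_ord1.
apply: linearP_eq => t; rewrite lin_sumE big_ord_recl.
rewrite -[tder m.+1 t]/((coder C \otL lid _) t + (lid C \otL tder m) t).
congr (_ + _); rewrite IHm; exact: (tmap_sumr (X := X)).
Qed.

Lemma comul_coder c :
  comul C (coder C c) = leibniz X (coder C) (coder C) (comul C c).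
Proof. by have /(congr1 (fun h : {linear _ -> _} => h c)) := coderP C. Qed.

Lemma cobar_tder m t : cobar C m (tder m t) = tder m.+1 (cobar C m t).
Proof.
elim: m t => [|m IHm] t.
  rewrite -[LHS]/(- comul C (coder C t)) comul_coder.
  exact: esym (linearN (tder 1) _).
exact: (cobar_leibniz_step (X := X) comul_coder IHm t).
Qed.

Lemma tder_consr m t :
  tder m.+1 (tpowS_consr C m t)
  = tpowS_consr C m ((tder m \otL lid C) t)
    + tpowS_consr C m ((lid (tpowS C m) \otL coder C) t).
Proof.
elim: m t => [|m IHm] t; first by [].
exact: (leibniz_consr_step (X := X) IHm t).
Qed.

Variable M : coderBicomodule C.

(** In degree [m + 1] the right coaction term has sign (-1)^(m+2), that is (-1)^m, and [tpow_consl]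
    is the identity. *)
Definition hochS m (f : cochain M m.+1) : cochain M m.+2 :=
  hoch (X := X) (lcoact M) (rcoact M) (cobar C m) (tpowS_consr C m)
    ((-1) ^+ m) f.

Lemma delta_cE m (f : cochain M m.+1) : delta_c f = hochS f.
Proof.
apply: linearP_eq => x.
rewrite -[RHS]/((lid C \otL f) (lcoact M x) + cobar C m (f x)
  + (-1) ^+ m *: tpowS_consr C m ((f \otL lid C) (rcoact M x))).
rewrite cobar_sum lin_sumE /delta_c !lin_addE lin_sumE.
by rewrite !exprS !mulN1r opprK.
Qed.

Lemma omegaE m (f : cochain M m.+1) :
  omega f = coder_comm (cbm_map M) (tder m) f.
Proof.
apply: linearP_eq => x.
rewrite -[RHS]/(tder m (f x) - f (cbm_map M x)) tder_sum lin_sumE.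
by rewrite /omega lin_addE lin_sumE.
Qed.

Lemma lcoactAE x : comull (X := X) (comul C) M (lcoact M x)
  = (lid C \otL lcoact M) (lcoact M x).
Proof. by have /(congr1 (fun h : {linear _ -> _} => h x)) := lcoactA M. Qed.

Lemma rcoactAE x : (lid M \otL comul C) (rcoact M x)
  = tassoc M C C ((rcoact M \otL lid C) (rcoact M x)).
Proof. by have /(congr1 (fun h : {linear _ -> _} => h x)) := rcoactA M. Qed.

Lemma lrcoactAE x : (lid C \otL rcoact M) (lcoact M x)
  = tassoc C M C ((lcoact M \otL lid C) (rcoact M x)).
Proof. by have /(congr1 (fun h : {linear _ -> _} => h x)) := lrcoactA M. Qed.

Lemma cbm_lcoactE x : lcoact M (cbm_map M x)
  = (lid C \otL cbm_map M) (lcoact M x) + (coder C \otL lid M) (lcoact M x).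
Proof. by have /(congr1 (fun h : {linear _ -> _} => h x)) := cbm_lcoact M. Qed.

Lemma cbm_rcoactE x : rcoact M (cbm_map M x)
  = (cbm_map M \otL lid C) (rcoact M x) + (lid M \otL coder C) (rcoact M x).
Proof. by have /(congr1 (fun h : {linear _ -> _} => h x)) := cbm_rcoact M. Qed.

Lemma delta_delta m (f : cochain M m.+1) : delta_c (delta_c f) = 0.
Proof.
(* The sign (-1)^(m+1) of the outer coboundary becomes the [- s] of [hoch_hoch]. *)
rewrite !delta_cE /hochS exprS mulN1r.
exact: (hoch_hoch (X := X) lcoactAE rcoactAE lrcoactAE f
  (@cobar_cobar _ C m) (@consr_consr _ C m) (@cobar_consr _ C m)).
Qed.

Lemma delta_omega m (f : cochain M m.+1) :
  delta_c (omega f) = omega (delta_c f).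
Proof.
rewrite !delta_cE !omegaE.
exact: (hoch_coder_comm (X := X) cbm_lcoactE cbm_rcoactE _ f
  (@cobar_tder m) (@tder_consr m)).
Qed.

Lemma delta_linear m : linear (@delta_c F C M m.+1).
Proof.
move=> a f g; rewrite !delta_cE; exact: (hoch_linear (X := X)).
Qed.

Lemma delta0 m : delta_c (0 : cochain M m.+1) = 0.
Proof.
by have := delta_linear (-1) (0 : cochain M m.+1) 0;
  rewrite scaler0 addr0 scaleN1r addNr.
Qed.

End Coderivation.

Theorem lemma3p2 (F : fieldType) (charF0 : [pchar F] =i pred0)
    (C : coderPair F) (M : coderBicomodule C)
    (n : nat) (n_ge1 : (1 <= n)%N) (x : coder_cochain M n) :
  coder_d (coder_d x) = 0.
Proof.
case: n n_ge1 x => [//|[|m]] _ x.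
  transitivity (delta_c (delta_c (x : cochain M 1)),
    delta_c (- omega (x : cochain M 1))
    + (-1) ^+ 2 *: omega (delta_c (x : cochain M 1))) => //.
  rewrite delta_delta -delta_omega sqrrN expr1n scale1r.
  (* Scalar -1 and second argument 0 take the sign out of [delta_c]. *)
  have := delta_linear (-1) (omega (x : cochain M 1)) 0.
  by rewrite delta0 !addr0 !scaleN1r => ->; rewrite addNr.
case: x => f g.
transitivity (delta_c (delta_c f), delta_c (delta_c g + (-1) ^+ m.+2 *: omega f)
  + (-1) ^+ m.+3 *: omega (delta_c f)) => //.
(* Moving [delta_c g] last gives the shape required by linearity; the two terms in [f] then carry
   opposite signs. *)
rewrite delta_delta (addrC (delta_c g)) delta_linear delta_delta addr0.
by rewrite -delta_omega -scalerDl [(-1) ^+ m.+3]exprS mulN1r subrr scale0r.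
Qed.
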